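(* For $j\ge 1$ let $\Delta_j =\frac{1}{j(j+1)}$ and $a_j=2^{2^j}$, and set $A=\bigcup_{j\ge 1} [a_j,a_j+\Delta_j]\subset\mathbb{R}$, a disjoint union of intervals of total Lebesgue measure $1$. Let $X_1,X_2,\dots$ be independent and identically distributed real random variables with density $f=\mathbb{I}_A$ (the indicator function of $A$), i.e. uniformly distributed on $A$. Then the Kozachenko--Leonenko nearest neighbor entropy estimate $H_n$ based on $X_1,\dots,X_n$ satisfies $$\lim_{n\rightarrow \infty }H_n=\infty \quad\text{in probability},$$ that is, for every real $K$, $\mathbb{P}\{H_n> K\}\to 1$ as $n\to\infty$.
   Context: For $n\ge 2$ and $1\le i\le n$, let $R_{n,i}(x)=\min_{j\ne i,\, j\le n}|x-X_j|$ for $x\in\mathbb{R}$. The Kozachenko--Leonenko nearest neighbor entropy estimate in dimension $d=1$ is $$H_n=\frac 1n \sum_{i=1}^{n}\ln \big((n-1)R_{n,i}(X_i)\, v_1\big)+ C_E,$$ where $v_1=2$ is the length of the unit ball $[-1,1]$ in $\mathbb{R}$ and $C_E=-\int_0^{\infty} e^{-t}\ln t\,dt$ is the Euler--Mascheroni constant ($0.5772\ldots$). Since $X_1,\dots,X_n$ are almost surely distinct, $H_n$ is almost surely a well-defined real number. *)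

(* Defs.v *)
From HB Require Import structures.
From mathcomp Require Export all_boot all_order all_algebra finmap.
From mathcomp Require Export all_classical all_reals all_analysis.
From mathcomp Require Import ring.

Set Implicit Arguments.
Unset Strict Implicit.
Unset Printing Implicit Defensive.

Import Order.TTheory GRing.Theory Num.Theory.
Import numFieldNormedType.Exports.

Local Open Scope classical_set_scope.
Local Open Scope ring_scope.

Definition Delta (R : realType) (j : nat) : R := (j * j.+1)%:R^-1.

Definition left_end (R : realType) (j : nat) : R := 2 ^+ (2 ^ j)%N.

Definition block (R : realType) (j : nat) : set R :=
  `[left_end R j, left_end R j + Delta R j].
Arguments block : clear implicits.

Definition supportA (R : realType) : set R :=
  \bigcup_(j in [set j | (1 <= j)%N]) block R j.
Arguments supportA : clear implicits.

Definition mutually_independent (R : realType) (d : measure_display)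
    (T : measurableType d) (P : probability T R) (I : choiceType)
    (X : I -> {RV P >-> R}) : Prop :=
  forall (J : {fset I}) (B : I -> set R),
    (forall i, measurable (B i)) ->
    (P (\bigcap_(i in [set` J]) X i @^-1` B i)
     = \prod_(i <- J) P (X i @^-1` B i))%E.

Definition has_density (R : realType) (d : measure_display)
    (T : measurableType d) (P : probability T R) (X : {RV P >-> R})
    (f : R -> R) : Prop :=
  forall B : set R, measurable B ->
    distribution P X B = (\int[lebesgue_measure]_(x in B) (f x)%:E)%E.

Definition euler_mascheroni (R : realType) : R :=
  - \int[lebesgue_measure]_(t in `]0, +oo[) (expR (- t) * ln t).

(* The minimum is taken in [\bar R], whose [+oo] is neutral for [mine]; it is
   finite as soon as [2 <= n]. *)
Definition nn_dist (R : realType) (x : nat -> R) (n : nat) (i : 'I_n) (y : R)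
    : R :=
  fine (\big[mine/+oo%E]_(j < n | j != i) (`|y - x j|)%:E).

(* Samples are indexed from 0: [x 0], ..., [x n.-1] stand for X_1, ..., X_n.
   The factor 2 is the length of the unit ball [-1, 1].  When two sample points
   coincide, the convention [ln 0 = 0] applies; for a sample with a density
   this is a null event. *)
Definition KL_entropy (R : realType) (x : nat -> R) (n : nat) : R :=
  n%:R^-1 * (\sum_(i < n) ln (n.-1%:R * nn_dist x i (x i) * 2))
  + euler_mascheroni R.

Definition cvg_pinfty_in_probability (R : realType) (d : measure_display)
    (T : measurableType d) (P : probability T R) (Y : nat -> T -> R) : Prop :=
  forall K : R, (fun n => P [set w | K < Y n w]) @ \oo --> 1%E.

Lemma trivIset_block (R : realType) :
  trivIset [set j | (1 <= j)%N] (block R).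
Proof.
have key i j : (1 <= i)%N -> (i < j)%N ->
    left_end R i + Delta R i < left_end R j.
  move=> i1 ij.
  have D1 : Delta R i < 1.
    rewrite /Delta invf_lt1; last by rewrite ltr0n muln_gt0 i1.
    by rewrite ltr1n; case: i i1 {ij} => // -[|i] _.
  apply: (@lt_le_trans _ _ (left_end R i + 1)); first by rewrite ltrD2l.
  rewrite /left_end -!natrX natr1 ler_nat.
  by rewrite ltn_exp2l// ltn_exp2l.
apply/trivIsetP => i j /= i1 j1 ij.
rewrite -subset0 /block => x [] /=; rewrite !in_itv /= => /andP[a b] /andP[c e].
move: ij; rewrite neq_ltn => /orP[ij|ji].
- by have := le_lt_trans (le_trans c b) (key _ _ i1 ij); rewrite ltxx.
- by have := le_lt_trans (le_trans a e) (key _ _ j1 ji); rewrite ltxx.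
Qed.

Lemma lebesgue_supportA (R : realType) :
  lebesgue_measure (supportA R) = 1%E.
Proof.
have S : supportA R = \bigcup_k block R k.+1.
  rewrite /supportA; apply/seteqP; split => x.
    by move=> [[|j]] //= _ h; exists j.
  by move=> [j _ h]; exists j.+1.
rewrite S measure_semi_bigcup /=; last 3 first.
- by move=> i; exact: measurable_itv.
- move=> i j _ _ h.
  have := @trivIset_block R i.+1 j.+1 isT isT h.
  by case.
- by apply: bigcup_measurable => i _; exact: measurable_itv.
apply/cvg_lim => //.
rewrite (_ : (fun n : nat => _) = (fun n => (1 - n.+1%:R^-1)%:E)); last first.
  apply/funext => n; elim: n => [|n IH].
    by rewrite big_geq// invr1 subrr.
  rewrite big_nat_recr//= IH /block lebesgue_measure_itv/= lte_fin ltrDl.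
  rewrite /Delta invr_gt0 ltr0n /= -EFinB -EFinD; congr EFin.
  have a0 : n.+1%:R != 0 :> R by rewrite pnatr_eq0.
  have b0 : n.+2%:R != 0 :> R by rewrite pnatr_eq0.
  rewrite [left_end _ _ + _]addrC addrK natrM.
  have -> : n.+2%:R = n.+1%:R + 1 :> R by rewrite natr1.
  by field; rewrite (addrC 1) !natr1 a0 b0.
apply: cvg_EFin; first exact: nearW.
rewrite -[X in _ --> X]subr0.
by apply: cvgB; [exact: cvg_cst | exact: cvg_harmonic].
Qed.

(* Main.v *)
Require Import Defs.
From mathcomp Require Import measurable_realfun zify ring lra.

Set Implicit Arguments.
Unset Strict Implicit.
Unset Printing Implicit Defensive.

Import Order.TTheory GRing.Theory Num.Theory.
Import numFieldNormedType.Exports.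

Local Open Scope classical_set_scope.
Local Open Scope ring_scope.

(** The density is bounded, so a sample of size [n] has no two points closer
    than [r = n^-3], except with probability of order [1/n]: every term of the
    average is at least [ln r = -3 ln n].  On the other hand the tail of the
    block index is heavy, [P (index > L) = 1/(L+1)], while the blocks are doubly
    exponentially far apart.  For [L] a small fraction of [n],
    - some sample point falls beyond block [L], except with probability
      [(1 - 1/(L+1))^n <= (L+1)/n];
    - no block beyond [L] receives two sample points, except with probability
      at most [n^2/(L+1)^3].
    Off these exceptional events some sample point beyond block [L] is alone in
    its block, hence at distance at least [2^(2^L)] from all the others, and its
    single term contributes [2^L ln 2 / n] to the average.  This grows
    exponentially in [n] and swamps [-3 ln n].

    The choice [L = 3 q] with [q = n %/ c] makes the exceptional probability
    at most [4/c + (c^2 + 3)/q] ([bad_bound_small]) and lets the crude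
    bound [2^(3 q) >= q^3] suffice for the growth ([lone_point_dominates]).  As
    [c] is arbitrary, convergence in probability follows.  The deterministic
    half of the argument is [KL_entropy_ge_off_bad], the probabilistic half is
    [prob_bad_le]; the latter reduces both kinds of coincidences between two
    sample points to a countable union of products of cells
    ([prob_pair_cells_le]), so that independence is only ever used on
    rectangles. *)

(** * Lower bounds on the entropy estimate *)

(** With [1 < n] some [k != i] exists, so the extended minimum is finite and
    [fine] does not send it to its default value [0]. *)
Lemma nn_dist_ge (R : realType) (x : nat -> R) (n : nat) (i : 'I_n) (r : R) :
  (1 < n)%N -> (forall k : 'I_n, k != i -> r <= `|x i - x k|) ->
  r <= nn_dist x i (x i).
Proof.
move=> n1 h; rewrite /nn_dist -lee_fin.
set m := (X in fine X).
have rm : (r%:E <= m)%E.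
  by apply: le_bigmin; [exact: leey | move=> k ki; rewrite lee_fin h].
have [k ki] : exists k : 'I_n, k != i.
  case: (posnP i) => i0.
    by exists (Ordinal n1); rewrite -val_eqE /= i0.
  by exists (Ordinal (ltnW n1)); rewrite -val_eqE /= eq_sym -lt0n.
have mk : (m <= (`|x i - x k|)%:E)%E by exact: bigmin_le_cond.
rewrite fineK// fin_numE; apply/andP; split; apply/eqP => m_inf.
- by move: rm; rewrite m_inf.
- by move: mk; rewrite m_inf.
Qed.

(** [s] is meant to be huge: the one well-isolated point [i0] contributes its
    own term, while the [n - 1] others are only bounded below, by [ln r]. *)
Lemma KL_entropy_ge (R : realType) (x : nat -> R) (n : nat) (i0 : 'I_n)
    (r s : R) :
  (1 < n)%N -> 0 < r -> r <= 1 -> 0 < s ->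
  (forall i k : 'I_n, k != i -> r <= `|x i - x k|) ->
  (forall k : 'I_n, k != i0 -> s <= `|x i0 - x k|) ->
  ln r + n%:R^-1 * ln s + euler_mascheroni R <= KL_entropy x n.
Proof.
move=> n1 r0 r1 s0 hr hs; rewrite /KL_entropy lerD2r.
have n0 : 0 < n%:R :> R by rewrite ltr0n (ltnW n1).
have term (i : 'I_n) (u : R) : 0 < u ->
    (forall k : 'I_n, k != i -> u <= `|x i - x k|) ->
    ln u <= ln (n.-1%:R * nn_dist x i (x i) * 2).
  move=> u0 hu; have uR := nn_dist_ge n1 hu.
  have nm1 : 1 <= n.-1%:R :> R by rewrite ler1n; lia.
  have : u <= n.-1%:R * nn_dist x i (x i) * 2 by nra.
  by move=> h; rewrite ler_ln// posrE (lt_le_trans u0).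
rewrite (bigD1 i0)//=.
have rest : n.-1%:R * ln r <=
    \sum_(i < n | i != i0) ln (n.-1%:R * nn_dist x i (x i) * 2).
  have -> : n.-1%:R * ln r = \sum_(i < n | i != i0) ln r.
    rewrite sumr_const cardC1 card_ord mulr_natl //.
  by apply: ler_sum => i _; apply: term => //; exact: hr.
have := term i0 s s0 hs.
have lr : ln r <= 0 by exact: ln_le0.
have nE : n%:R = n.-1%:R + 1 :> R by rewrite natr1 prednK// (ltnW n1).
(* The assumption [r <= 1] is what allows replacing [n.-1] by [n] in front of
   [ln r]. *)
move=> ls; rewrite -(ler_pM2l n0) mulrDr !mulrA mulfV ?gt_eqF// !mul1r.
rewrite nE mulrDl mul1r; lra.
Qed.

(** Each left end is the square of the previous one, so the gap before block
    [j] has length at least [left_end R j.-1].  Points of two distinct blocks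
    are therefore very far apart as soon as one of the blocks has a large
    index. *)
Lemma left_end_gap (R : realType) (i j : nat) : (1 <= i)%N -> (i < j)%N ->
  left_end R i + Delta R i + left_end R j.-1 <= left_end R j.
Proof.
move=> i1 ij.
have D1 : Delta R i <= 1.
  by rewrite /Delta invf_le1 ?ler1n ?ltr0n ?muln_gt0 ?i1.
case: j ij => // j; rewrite ltnS /= => ij.
have le_ij : left_end R i <= left_end R j.
  by rewrite /left_end ler_eXn2l ?ltr1n// leq_exp2l.
(* For [a >= 4], [2 * a + 1 <= a * a]. *)
have a4 : 4 <= left_end R j.
  have -> : 4 = 2 ^+ 2 :> R by rewrite expr2 -natrM.
  rewrite /left_end ler_eXn2l ?ltr1n//.
  by rewrite -[leqLHS](expn1 2) leq_exp2l// (leq_trans i1).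
have -> : left_end R j.+1 = left_end R j * left_end R j.
  by rewrite /left_end expnS mul2n -addnn exprD.
nra.
Qed.

Lemma block_dist_ge (R : realType) (L i j : nat) (x y : R) :
  (L < i)%N -> (1 <= j)%N -> i != j -> block R i x -> block R j y ->
  left_end R L <= `|x - y|.
Proof.
move=> Li j1; rewrite /block /= !in_itv/= neq_ltn.
have mono k : (L <= k)%N -> left_end R L <= left_end R k.
  by move=> Lk; rewrite /left_end ler_eXn2l ?ltr1n// leq_exp2l.
move=> /orP[ij|ji] /andP[x1 x2] /andP[y1 y2].
- have g := left_end_gap R (leq_ltn_trans (leq0n L) Li) ij.
  have m := mono j.-1 ltac:(lia).
  rewrite distrC; apply: le_trans (ler_norm _); lra.
- have g := left_end_gap R j1 ji.
  have m := mono i.-1 ltac:(lia).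
  apply: le_trans (ler_norm _); lra.
Qed.

(** * Growth of the contribution of a remote point *)

(** The exponential [2 ^ (3 q)] is only needed to beat a quadratic in [q];
    the cube [q^3], from [q <= 2 ^ q], is enough and keeps the comparison
    polynomial. *)
Lemma ln_left_end_ge (R : realType) (q : nat) :
  q%:R ^+ 3 / 2 <= ln (left_end R (3 * q)).
Proof.
have ln2 : 2^-1 <= ln 2 :> R.
  rewrite -ler_expR lnK ?posrE//.
  have /(_ (- 2^-1)) := @expR_ge1Dx R; rewrite expRN => h.
  have e0 := expR_gt0 (2^-1 : R).
  have := mulVf (lt0r_neq0 e0); nra.
rewrite /left_end lnXn// -[leRHS]mulr_natl.
apply: ler_pM => //.
rewrite -natrX ler_nat mulnC expnM leq_exp2r//.
exact/ltnW/ltn_expl.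
Qed.

(** With [n] comparable to [q], the first logarithm is at least [-3 n], linear
    in [q], and the second term is of order at least [q^2]. *)
Lemma lone_point_dominates (R : realType) (c : nat) (K : R) : (0 < c)%N ->
  \forall q \near \oo, forall n : nat, (0 < n)%N -> (c * q <= n < c * q.+1)%N ->
    K < ln (n%:R ^- 3) + n%:R^-1 * ln (left_end R (3 * q)).
Proof.
move=> c0.
have [Q hQ] : exists Q : nat, (`|K| + 12 * c%:R + 1) * (4 * c%:R) <= Q%:R.
  by exists (Num.truncn ((`|K| + 12 * c%:R + 1) * (4 * c%:R))).+1;
    apply/ltW/truncnS_gt.
exists Q.+1 => // q /= Qq n n0 /andP[qn nq].
have Qq' : Q%:R + 1 <= q%:R :> R by rewrite natr1 ler_nat.
have c1 : 1 <= c%:R :> R by rewrite ler1n.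
have nR0 : 1 <= n%:R :> R by rewrite ler1n.
have nR : n%:R <= c%:R * (q%:R + 1) :> R.
  by rewrite natr1 -natrM ler_nat ltnW.
have K0 : K <= `|K| := ler_norm K.
have K1 : 0 <= `|K| := normr_ge0 K.
have q1 : 1 <= q%:R :> R by nra.
have lnn : ln (n%:R : R) <= n%:R.
  have n1 : -1 < n%:R - 1 :> R by lra.
  by have := le_ln1Dx n1; rewrite [1 + _]addrC subrK; lra.
rewrite lnV ?posrE ?exprn_gt0 ?ltr0n// lnXn ?ltr0n// -[ln _ *+ 3]mulr_natl.
have L := ln_left_end_ge R q.
have n0R : 0 < n%:R :> R by lra.
rewrite -(ltr_pM2l n0R) mulrDr !mulrA mulfV ?gt_eqF// !mul1r.
apply: lt_le_trans (_ : n%:R * (- (3 * ln n%:R)) + q%:R ^+ 3 / 2 <= _);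
  last by rewrite lerD2l.
have n2 : n%:R <= 2 * c%:R * q%:R :> R by nra.
have : n%:R * (K + 3 * n%:R) <= 2 * c%:R * q%:R * (`|K| + 6 * c%:R * q%:R) :> R.
  apply: (@le_trans _ _ (n%:R * (`|K| + 6 * c%:R * q%:R)));
    last by apply: ler_wpM2r => //; nra.
  by apply: ler_wpM2l; nra.
have : 2 * c%:R * q%:R * (`|K| + 6 * c%:R * q%:R) < q%:R ^+ 3 / 2 :> R.
  have -> : q%:R ^+ 3 / 2 = 2 * c%:R * q%:R * (q%:R ^+ 2 / (4 * c%:R)) :> R by field; lra.
  rewrite ltr_pM2l; last by nra.
  rewrite ltr_pdivlMr; last by nra.
  rewrite expr2.
  apply: (@lt_le_trans _ _ ((`|K| + 12 * c%:R + 1) * (4 * c%:R) * q%:R)).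
    nra.
  by apply: ler_wpM2r; nra.
nra.
Qed.

(** * The law of the block index *)

Lemma measurable_block (R : realType) (j : nat) : measurable (block R j).
Proof. exact: measurable_itv. Qed.

Lemma lebesgue_block (R : realType) (j : nat) : (1 <= j)%N ->
  lebesgue_measure (block R j) = (Delta R j)%:E.
Proof.
move=> j1; have D0 : 0 < Delta R j.
  by rewrite /Delta invr_gt0 ltr0n muln_gt0 j1.
rewrite /block lebesgue_measure_itv/= lte_fin ltrDl D0 -EFinB.
by rewrite [left_end _ _ + _]addrC addrK.
Qed.

Lemma measurable_supportA (R : realType) : measurable (supportA R).
Proof. by apply: bigcup_measurable => j _; exact: measurable_block. Qed.

Definition low_blocks (R : realType) (L : nat) : set R :=
  \big[setU/set0]_(j < L) block R j.+1.
Arguments low_blocks : clear implicits.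

Lemma lowP (R : realType) (L : nat) (x : R) :
  low_blocks R L x <-> exists2 j, (1 <= j <= L)%N & block R j x.
Proof.
rewrite /low_blocks -(bigcup_mkord L (fun j => block R j.+1)); split.
  by move=> [j /= jL xj]; exists j.+1.
by move=> [[//|j] jL xj]; exists j.
Qed.

Lemma measurable_low (R : realType) (L : nat) : measurable (low_blocks R L).
Proof. by apply: bigsetU_measurable => j _; exact: measurable_block. Qed.

(** The sum of the lengths telescopes. *)
Lemma lebesgue_low (R : realType) (L : nat) :
  lebesgue_measure (low_blocks R L) = (1 - L.+1%:R^-1)%:E.
Proof.
elim: L => [|L IH]; first by rewrite /low_blocks big_ord0 measure0 invr1 subrr.
rewrite /low_blocks big_ord_recr/= measureU; last 3 first.
- exact: measurable_low.
- exact: measurable_block.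
- rewrite -subset0 => x [/lowP[j jL xj] xL].
  have /trivIsetP/(_ j L.+1) := @trivIset_block R.
  move=> /(_ ltac:(case/andP: jL => //)); move=> /(_ isT).
  have jneq : j != L.+1 by lia.
  by move=> /(_ jneq) E; rewrite -E.
rewrite [X in (X + _)%E]IH [X in (_ + X)%E](lebesgue_block R (ltn0Sn L)).
rewrite -EFinD /Delta; congr EFin.
have a0 : L.+1%:R != 0 :> R by rewrite pnatr_eq0.
have b0 : L.+2%:R != 0 :> R by rewrite pnatr_eq0.
move: a0 b0; rewrite natrM -[L.+2%:R]natr1; move: (L.+1%:R : R) => a a0 b0.
by field; rewrite a0 b0.
Qed.

Lemma preimage_law (R : realType) (d : measure_display) (Omega : measurableType d)
    (P : probability Omega R) (Y : {RV P >-> R}) (B : set R) :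
  has_density Y (\1_(supportA R)) -> measurable B ->
  P (Y @^-1` B) = lebesgue_measure (supportA R `&` B).
Proof.
move=> hY mB; have := hY B mB; rewrite integral_indic//.
exact: measurable_supportA.
Qed.

(** The density is bounded by [1]. *)
Lemma preimage_law_le (R : realType) (d : measure_display)
    (Omega : measurableType d) (P : probability Omega R) (Y : {RV P >-> R})
    (B : set R) :
  has_density Y (\1_(supportA R)) -> measurable B ->
  (P (Y @^-1` B) <= lebesgue_measure B)%E.
Proof.
move=> hY mB; rewrite (preimage_law hY mB); apply: le_measure; rewrite ?inE//.
by apply: measurableI => //; exact: measurable_supportA.
Qed.

Lemma measurable_RV (R : realType) (d : measure_display)
    (Omega : measurableType d) (P : probability Omega R) (Y : {RV P >-> R})
    (B : set R) : measurable B -> measurable (Y @^-1` B).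
Proof. by move=> mB; exact: measurable_funPTI. Qed.

Lemma prob_notin_supportA (R : realType) (d : measure_display)
    (Omega : measurableType d) (P : probability Omega R) (Y : {RV P >-> R}) :
  has_density Y (\1_(supportA R)) -> P (Y @^-1` (~` supportA R)) = 0%E.
Proof.
move=> hY; rewrite preimage_law ?setICr ?measure0//.
by apply: measurableC; exact: measurable_supportA.
Qed.

Lemma prob_low (R : realType) (d : measure_display)
    (Omega : measurableType d) (P : probability Omega R) (Y : {RV P >-> R})
    (L : nat) : has_density Y (\1_(supportA R)) ->
  P (Y @^-1` low_blocks R L) = (1 - L.+1%:R^-1)%:E.
Proof.
move=> hY; rewrite preimage_law//; last exact: measurable_low.
rewrite setIidr ?lebesgue_low// => x /lowP[j jL xj].
by exists j => //=; case/andP: jL.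
Qed.

(** * Consequences of independence *)

(** Bernoulli's inequality in the form [(1 - u)^n (1 + n u) <= 1]. *)
Lemma subr_expn_le (R : realFieldType) (u : R) (n : nat) :
  (0 < n)%N -> 0 < u -> u <= 1 -> (1 - u) ^+ n <= (n%:R * u)^-1.
Proof.
move=> n0 u0 u1.
have v0 : 0 <= 1 - u by lra.
have key : (1 - u) ^+ n * (1 + n%:R * u) <= 1.
  elim: n {n0} => [|n IH]; first by rewrite expr0 mul0r addr0 mul1r.
  apply: le_trans IH; rewrite exprSr -mulrA; apply: ler_wpM2l.
    exact: exprn_ge0.
  have : 0 <= n%:R :> R by [].
  rewrite -natr1; nra.
have nR : 0 < n%:R :> R by rewrite ltr0n.
rewrite -[leRHS]mul1r ler_pdivlMr ?mulr_gt0//.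
apply: le_trans key; rewrite ler_wpM2l ?exprn_ge0//; lra.
Qed.

Lemma indep_pair (R : realType) (d : measure_display) (Omega : measurableType d)
    (P : probability Omega R) (X : nat -> {RV P >-> R}) (i k : nat)
    (E F : set R) : mutually_independent X -> i != k ->
  measurable E -> measurable F ->
  P (X i @^-1` E `&` X k @^-1` F) = (P (X i @^-1` E) * P (X k @^-1` F))%E.
Proof.
move=> hX ik mE mF.
pose B l := if l == i then E else F.
have mB l : measurable (B l) by rewrite /B; case: ifP.
have := hX [fset i; k]%fset B mB.
rewrite big_fsetU1/= ?inE// big_seq_fset1 {2 3}/B eqxx eq_sym (negPf ik) => <-.
congr (P _); apply/seteqP; split => w.
  move=> [wi wk] l /=; rewrite !inE /B => /orP[] /eqP ->; first by rewrite eqxx.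
  by rewrite eq_sym (negPf ik).
move=> h; have := h i; have := h k; rewrite /= !inE !eqxx orbT /B eqxx.
by rewrite eq_sym (negPf ik) => /(_ isT) wk /(_ isT) wi.
Qed.

Lemma indep_all (R : realType) (d : measure_display) (Omega : measurableType d)
    (P : probability Omega R) (X : nat -> {RV P >-> R}) (n : nat) (B : set R)
    (p : R) : mutually_independent X -> measurable B ->
  (forall i, P (X i @^-1` B) = p%:E) ->
  P (\bigcap_(i in `I_n) X i @^-1` B) = (p ^+ n)%:E.
Proof.
move=> hX mB hp.
pose J := [fset i | i in iota 0 n]%fset.
have JE : perm_eq J (iota 0 n).
  apply: uniq_perm; rewrite ?fset_uniq ?iota_uniq// => i.
  by rewrite !inE.
have -> : `I_n = [set` J].
  apply/seteqP; split => i /=; rewrite !inE /= mem_iota //.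
rewrite (hX J (fun=> B))// (perm_big _ JE)/= (eq_bigr (fun=> p%:E))//.
by rewrite prodEFin -{1}(subn0 n) prodr_const_nat subn0.
Qed.

(** A bound for a two-dimensional event covered by disjoint strips: conditioning
    on the strip [E m] that contains [X i], the point [X k] must fall in [F m],
    which has probability at most [s].  Only the product rule on rectangles is
    used, so no joint law has to be introduced. *)
Lemma prob_pair_cells_le (R : realType) (d : measure_display)
    (Omega : measurableType d) (P : probability Omega R)
    (X : nat -> {RV P >-> R}) (i k : nat) (E F : nat -> set R) (s : R) :
  mutually_independent X -> i != k -> 0 <= s ->
  (forall m, measurable (E m)) -> (forall m, measurable (F m)) ->
  trivIset setT E -> (forall m, P (X k @^-1` F m) <= s%:E)%E ->
  (P (\bigcup_m (X i @^-1` E m `&` X k @^-1` F m))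
   <= s%:E * P (X i @^-1` \bigcup_m E m))%E.
Proof.
move=> hX ik s0 mE mF tE hs.
have mEF m : measurable (X i @^-1` E m `&` X k @^-1` F m).
  by apply: measurableI; apply: measurable_RV.
have tXE : trivIset setT (fun m => X i @^-1` E m).
  apply/trivIsetP => m l _ _ ml; rewrite -preimage_setI.
  by move/trivIsetP : tE => ->//; rewrite preimage_set0.
have -> : X i @^-1` (\bigcup_m E m) = \bigcup_m (X i @^-1` E m).
  by rewrite preimage_bigcup.
apply: (le_trans (generalized_Boole_inequality P mEF _)).
  exact: bigcup_measurable.
rewrite measure_bigcup//; last by move=> m _; exact: measurable_RV.
rewrite -nneseriesZl//.
under [leRHS]eq_eseriesl do rewrite in_setT.
apply: lee_nneseries => // m _.
by rewrite [leLHS](indep_pair hX ik (mE m) (mF m)) muleC; apply: lee_wpmul2r.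
Qed.

(** * Coincidences between two sample points *)

(** A cover of the event that [Y] and [Z] are closer than [r]: the half-line is
    cut into cells of length [r], and [Z] must lie in the cell of [Y] or within
    [r] of it.  Only nonnegative [Y] matter, since the support lies in the
    half-line. *)
Definition near_event (R : realType) (T : Type) (Y Z : T -> R) (r : R) : set T :=
  \bigcup_m (Y @^-1` `[m%:R * r, m.+1%:R * r[ `&`
             Z @^-1` `[m%:R * r - r, m.+1%:R * r + r]).

Definition same_block (R : realType) (T : Type) (Y Z : T -> R) (L : nat) : set T :=
  \bigcup_m (Y @^-1` block R (L + m).+1 `&` Z @^-1` block R (L + m).+1).

Lemma near_eventP (R : realType) (T : Type) (Y Z : T -> R) (r : R) (w : T) :
  0 < r -> 0 <= Y w -> ~ near_event Y Z r w -> r <= `|Y w - Z w|.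
Proof.
move=> r0 Y0; apply: contra_notP => /negP; rewrite -ltNge => YZ.
have /truncn_itv : 0 <= Y w / r by rewrite divr_ge0// ltW.
rewrite ler_pdivlMr// ltr_pdivrMr// => /andP[Y1 Y2].
exists (Num.truncn (Y w / r)) => //; split; rewrite /= in_itv/= ?Y1 ?Y2//.
by move: YZ; rewrite ltr_norml => /andP[a b]; apply/andP; split; lra.
Qed.

Lemma prob_near_event_le (R : realType) (d : measure_display)
    (Omega : measurableType d) (P : probability Omega R)
    (X : nat -> {RV P >-> R}) (i k : nat) (r : R) :
  mutually_independent X -> (forall i, has_density (X i) (\1_(supportA R))) ->
  i != k -> 0 < r -> (P (near_event (X i) (X k) r) <= (3 * r)%:E)%E.
Proof.
move=> hX hd ik r0.
have s0 : 0 <= 3 * r by lra.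
apply: (le_trans (prob_pair_cells_le hX ik s0 _ _ _ _)).
- by move=> m; exact: measurable_itv.
- by move=> m; exact: measurable_itv.
- apply/trivIsetP => m l _ _ ml; rewrite -subset0 => x [] /=.
  rewrite !in_itv/= => /andP[m1 m2] /andP[l1 l2].
  have := le_lt_trans m1 l2; have := le_lt_trans l1 m2.
  rewrite !ltr_pM2r// !ltr_nat; lia.
- move=> m; apply: (le_trans (preimage_law_le (hd k) (measurable_itv _))).
  rewrite lebesgue_measure_itv/= lte_fin; case: ifP => // _.
  by rewrite -EFinB lee_fin -natr1; lra.
- rewrite -[leRHS]mule1; apply: lee_wpmul2l; rewrite ?lee_fin//.
  apply: probability_le1; apply: measurable_RV.
  by apply: bigcup_measurable => m _; exact: measurable_itv.
Qed.

(** The exponent [3] comes from two sources: [X i] lies beyond block [L] with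
    probability [1/(L+1)], and each block beyond [L] has length at most
    [1/(L+1)^2].  The first factor is essential, as the [n^2] pairs are to be
    summed over with [L] proportional to [n]. *)
Lemma prob_same_block_le (R : realType) (d : measure_display)
    (Omega : measurableType d) (P : probability Omega R)
    (X : nat -> {RV P >-> R}) (i k : nat) (L : nat) :
  mutually_independent X -> (forall i, has_density (X i) (\1_(supportA R))) ->
  i != k -> (P (same_block (X i) (X k) L) <= (L.+1%:R ^- 3)%:E)%E.
Proof.
move=> hX hd ik.
have s0 : 0 <= L.+1%:R ^- 2 :> R by rewrite invr_ge0 exprn_ge0.
apply: (le_trans (prob_pair_cells_le hX ik s0 _ _ _ _)).
- by move=> m; exact: measurable_block.
- by move=> m; exact: measurable_block.
- apply/trivIsetP => m l _ _ ml.
  have /trivIsetP := @trivIset_block R; apply => //; lia.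
- move=> m; apply: (le_trans (preimage_law_le (hd k) _)).
    exact: measurable_block.
  rewrite [leLHS](lebesgue_block R (ltn0Sn _)) lee_fin.
  rewrite /Delta lef_pV2 ?posrE ?exprn_gt0 ?ltr0n//.
  by rewrite -natrX ler_nat expnS expn1 leq_mul//; lia.
- have -> : L.+1%:R ^- 3 = L.+1%:R ^- 2 * L.+1%:R^-1 :> R.
    by rewrite exprSr invfM mulrC.
  rewrite EFinM; apply: lee_wpmul2l; rewrite ?lee_fin//.
  have mE : measurable (\bigcup_m block R (L + m).+1).
    by apply: bigcup_measurable => m _; exact: measurable_block.
  have -> : (L.+1%:R^-1)%:E = P (X i @^-1` (~` low_blocks R L)).
    rewrite preimage_setC probability_setC; last first.
      by apply: measurable_RV; exact: measurable_low.
    by rewrite prob_low// -EFinB subKr.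
  apply: le_measure; rewrite ?inE; [exact: measurable_RV| |].
    by apply: measurable_RV; apply: measurableC; exact: measurable_low.
  move=> w [m _ wm] /= /lowP[j jL wj].
  have /trivIsetP/(_ j (L + m).+1) := @trivIset_block R.
  have j1 : (1 <= j)%N by lia.
  have jm : j != (L + m).+1 by lia.
  by move=> /(_ j1 isT jm) E; have : set0 (X i w) by rewrite -E.
Qed.

(** The family [C] is only controlled for distinct indices; the diagonal is
    emptied so that unions over ordinals and a plain union bound can be used. *)
Definition pair_union (T : Type) (C : nat -> nat -> set T) (n : nat) : set T :=
  \big[setU/set0]_(i < n) \big[setU/set0]_(k < n)
    (if i == k :> nat then set0 else C i k).

Lemma pair_unionP (T : Type) (C : nat -> nat -> set T) (n : nat) (w : T)
    (i k : 'I_n) : ~ pair_union C n w -> k != i -> ~ C i k w.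
Proof.
move=> h ki wC; apply: h; rewrite /pair_union.
rewrite -(bigcup_mkord n (fun i => \big[setU/set0]_(k < n)
  (if i == k :> nat then set0 else C i k))).
exists (val i) => /=; first exact: ltn_ord.
rewrite -(bigcup_mkord n (fun k => (if i == k :> nat then set0 else C i k))).
exists (val k) => /=; first exact: ltn_ord.
by rewrite eq_sym val_eqE (negPf ki).
Qed.

Lemma measurable_pair_union (d : measure_display) (T : measurableType d)
    (C : nat -> nat -> set T) (n : nat) :
  (forall i k, measurable (C i k)) -> measurable (pair_union C n).
Proof.
move=> mC; apply: bigsetU_measurable => i _.
by apply: bigsetU_measurable => k _; case: ifP.
Qed.

Lemma prob_pair_union_le (R : realType) (d : measure_display)
    (Omega : measurableType d) (P : probability Omega R)
    (C : nat -> nat -> set Omega) (n : nat) (s : R) :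
  0 <= s -> (forall i k, measurable (C i k)) ->
  (forall i k, i != k -> P (C i k) <= s%:E)%E ->
  (P (pair_union C n) <= (n%:R ^+ 2 * s)%:E)%E.
Proof.
move=> s0 mC hC.
pose D i k := if i == k then set0 else C i k.
have mD i k : measurable (D i k) by rewrite /D; case: ifP.
have mDi i : measurable (\big[setU/set0]_(k < n) D i k).
  by apply: bigsetU_measurable.
apply: (@le_trans _ _ (\sum_(i < n) \sum_(k < n) s%:E)%E).
  apply: (le_trans (@Boole_inequality _ _ _ P
    (fun i => \big[setU/set0]_(k < n) D i k) n _)) => //.
  apply: lee_sum => i _.
  apply: (le_trans (@Boole_inequality _ _ _ P (D i) n _)) => //.
  apply: lee_sum => k _; rewrite /D; case: ifPn => [_|]; last exact: hC.
  by rewrite measure0 lee_fin.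
rewrite !sumEFin lee_fin !sumr_const !card_ord -mulrnA.
by rewrite -[s *+ _]mulr_natl natrM -expr2.
Qed.

Lemma measurable_near_event (R : realType) (d : measure_display)
    (Omega : measurableType d) (P : probability Omega R)
    (Y Z : {RV P >-> R}) (r : R) : measurable (near_event Y Z r).
Proof.
apply: bigcup_measurable => m _.
by apply: measurableI; apply: measurable_RV; exact: measurable_itv.
Qed.

Lemma measurable_same_block (R : realType) (d : measure_display)
    (Omega : measurableType d) (P : probability Omega R)
    (Y Z : {RV P >-> R}) (L : nat) : measurable (same_block Y Z L).
Proof.
apply: bigcup_measurable => m _.
by apply: measurableI; apply: measurable_RV; exact: measurable_block.
Qed.

(** * The exceptional event *)

(** The four parts: a point outside the support, which is null; all points in
    the first [L] blocks; two points in one block beyond [L]; two points closer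
    than [r]. *)
Definition bad_event (R : realType) (T : Type) (X : nat -> T -> R) (n L : nat) (r : R)
    : set T :=
  (\big[setU/set0]_(i < n) X i @^-1` (~` supportA R) `|`
   \bigcap_(i in `I_n) X i @^-1` low_blocks R L) `|`
  (pair_union (fun i k => same_block (X i) (X k) L) n `|`
   pair_union (fun i k => near_event (X i) (X k) r) n).

(** Off the exceptional event some point lies in a block of index above [L],
    alone there, hence at distance at least [left_end R L] from every other one. *)
Lemma KL_entropy_ge_off_bad (R : realType) (T : Type) (X : nat -> T -> R)
    (n L : nat) (r : R) (w : T) : (1 < n)%N -> 0 < r -> r <= 1 ->
  ~ bad_event X n L r w ->
  ln r + n%:R^-1 * ln (left_end R L) + euler_mascheroni R
  <= KL_entropy (fun i => X i w) n.
Proof.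
move=> n1 r0 r1 good.
have inA (i : 'I_n) : supportA R (X i w).
  apply: contrapT => niA; apply: good; left; left.
  rewrite -(bigcup_mkord n (fun i => X i @^-1` (~` supportA R))).
  by exists (val i) => //=; exact: ltn_ord.
have [i0 i0n] : exists i0 : 'I_n, ~ low_blocks R L (X i0 w).
  apply: contrapT => /forallNP h; apply: good; left; right => i /= in_.
  by have /contrapT := h (Ordinal in_).
have noblock (i k : 'I_n) : k != i -> ~ same_block (X i) (X k) L w.
  apply: (@pair_unionP _ (fun i k => same_block (X i) (X k) L)) => h.
  by apply: good; right; left.
have nonear (i k : 'I_n) : k != i -> ~ near_event (X i) (X k) r w.
  apply: (@pair_unionP _ (fun i k => near_event (X i) (X k) r)) => h.
  by apply: good; right; right.
have [j0 /= j01 wj0] := inA i0.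
have Lj0 : (L < j0)%N.
  rewrite ltnNge; apply/negP => jL; apply: i0n; apply/lowP.
  by exists j0; rewrite ?j01.
apply: (@KL_entropy_ge _ _ _ i0) => //.
- by rewrite /left_end exprn_gt0.
- move=> i k ki; apply: (near_eventP r0); last exact: nonear.
  have [j _] := inA i; rewrite /block/= in_itv/= => /andP[+ _].
  by apply: le_trans; rewrite /left_end exprn_ge0.
- move=> k ki; have [j /= j1 wj] := inA k.
  have [jE|jj0] := eqVneq j0 j; last exact: (block_dist_ge Lj0 j1 jj0 wj0 wj).
  exfalso; apply: (noblock i0 k ki); exists (j0 - L.+1)%N => //.
  have -> : (L + (j0 - L.+1)).+1 = j0 by lia.
  by split => //=; rewrite jE.
Qed.

Lemma measurable_bad (R : realType) (d : measure_display)
    (Omega : measurableType d) (P : probability Omega R)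
    (X : nat -> {RV P >-> R}) (n L : nat) (r : R) : measurable (bad_event X n L r).
Proof.
apply: measurableU; apply: measurableU.
- apply: bigsetU_measurable => i _; apply: measurable_RV.
  by apply: measurableC; exact: measurable_supportA.
- apply: bigcap_measurableType => i _; apply: measurable_RV; exact: measurable_low.
- by apply: measurable_pair_union => i k; exact: measurable_same_block.
- by apply: measurable_pair_union => i k; exact: measurable_near_event.
Qed.

Lemma prob_bad_le (R : realType) (d : measure_display)
    (Omega : measurableType d) (P : probability Omega R)
    (X : nat -> {RV P >-> R}) (n L : nat) (r : R) :
  mutually_independent X -> (forall i, has_density (X i) (\1_(supportA R))) ->
  (0 < n)%N -> 0 < r ->
  (P (bad_event X n L r) <= (L.+1%:R / n%:R + n%:R ^+ 2 * L.+1%:R ^- 3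
                       + 3 * n%:R ^+ 2 * r)%:E)%E.
Proof.
move=> hX hd n0 r0.
have mA i : measurable (X i @^-1` (~` supportA R)).
  by apply: measurable_RV; apply: measurableC; exact: measurable_supportA.
have m1 : measurable (\big[setU/set0]_(i < n) X i @^-1` (~` supportA R)).
  exact: bigsetU_measurable.
have m2 : measurable (\bigcap_(i in `I_n) X i @^-1` low_blocks R L).
  by apply: bigcap_measurableType => i _; apply: measurable_RV; exact: measurable_low.
have m3 : measurable (pair_union (fun i k => same_block (X i) (X k) L) n).
  by apply: measurable_pair_union => i k; exact: measurable_same_block.
have m4 : measurable (pair_union (fun i k => near_event (X i) (X k) r) n).
  by apply: measurable_pair_union => i k; exact: measurable_near_event.
have L0 : 0 < L.+1%:R :> R by rewrite ltr0n.
have p1 : (P (\big[setU/set0]_(i < n) X i @^-1` (~` supportA R)) <= 0)%E.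
  apply: (le_trans (@Boole_inequality _ _ _ P
    (fun i => X i @^-1` (~` supportA R)) n _)) => //.
  by rewrite big1// => i _; exact: prob_notin_supportA.
have p2 : (P (\bigcap_(i in `I_n) X i @^-1` low_blocks R L) <=
    (L.+1%:R / n%:R)%:E)%E.
  rewrite (indep_all _ hX (@measurable_low R L) (fun i => prob_low L (hd i))).
  rewrite lee_fin; apply: le_trans (subr_expn_le n0 _ _) _.
  - by rewrite invr_gt0.
  - by rewrite invf_le1 ?ler1n.
  - by rewrite invfM invrK mulrC.
have p3 := @prob_pair_union_le _ _ _ P (fun i k => same_block (X i) (X k) L) n
  (L.+1%:R ^- 3) ltac:(by rewrite invr_ge0 exprn_ge0)
  (fun i k => measurable_same_block _ _ _)
  (fun i k => @prob_same_block_le _ _ _ P X i k L hX hd).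
have p4 := @prob_pair_union_le _ _ _ P (fun i k => near_event (X i) (X k) r) n
  (3 * r) ltac:(lra)
  (fun i k => measurable_near_event _ _ _)
  (fun i k ik => @prob_near_event_le _ _ _ P X i k r hX hd ik r0).
have U (A B : set Omega) (a b : R) : measurable A -> measurable B ->
    (P A <= a%:E)%E -> (P B <= b%:E)%E -> (P (A `|` B) <= (a + b)%:E)%E.
  move=> mA' mB pA pB; apply: (le_trans (measureU2 _ _ _)) => //.
  by rewrite EFinD; apply: leeD.
have -> : L.+1%:R / n%:R + n%:R ^+ 2 * L.+1%:R ^- 3 + 3 * n%:R ^+ 2 * r =
  (0 + L.+1%:R / n%:R) + (n%:R ^+ 2 * L.+1%:R ^- 3 + n%:R ^+ 2 * (3 * r)) by ring.
by apply: (U _ _ _ _); [exact: measurableU|exact: measurableU|exact: U|exact: U].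
Qed.

(** For [c * q <= n < c * (q + 1)] the three terms are at most [4/c], [c^2/q]
    and [3/q].  The first one does not vanish in the limit: it fixes [c] in
    terms of [e], and then [q] is sent to infinity. *)
Lemma bad_bound_small (R : realType) (e : R) : 0 < e ->
  exists2 c : nat, (0 < c)%N &
  \forall q \near \oo, forall n : nat, (0 < n)%N -> (c * q <= n < c * q.+1)%N ->
    (3 * q).+1%:R / n%:R + n%:R ^+ 2 * (3 * q).+1%:R ^- 3
    + 3 * n%:R ^+ 2 * n%:R ^- 3 <= e.
Proof.
move=> e0.
(* [4/c <= e/2]. *)
have [c c0 hc] : exists2 c : nat, (0 < c)%N & 8 <= e * c%:R.
  exists (Num.truncn (8 / e)).+1 => //.
  by rewrite [e * _]mulrC -ler_pdivrMr//; apply/ltW/truncnS_gt.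
exists c => //.
(* [(c^2 + 3)/q <= e/2] for [q >= Q]. *)
have [Q hQ] : exists Q : nat, 2 * (c%:R ^+ 2 + 3) <= e * Q%:R.
  exists (Num.truncn (2 * (c%:R ^+ 2 + 3) / e)).+1.
  by rewrite [e * _]mulrC -ler_pdivrMr//; apply/ltW/truncnS_gt.
exists Q.+1 => // q /= Qq n n0 /andP[qn nq].
have nR0 : 0 < n%:R :> R by rewrite ltr0n.
have Qq' : Q%:R <= q%:R :> R by rewrite ler_nat ltnW.
have q1 : 1 <= q%:R :> R by rewrite ler1n; lia.
have c1 : 1 <= c%:R :> R by rewrite ler1n.
have nR : n%:R <= c%:R * (q%:R + 1) :> R by rewrite natr1 -natrM ler_nat ltnW.
have nR' : c%:R * q%:R <= n%:R :> R by rewrite -natrM ler_nat.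
rewrite -natr1 natrM.
have t1 : (3 * q%:R + 1) / n%:R <= 4 / c%:R :> R.
  rewrite ler_pdivrMr// mulrAC ler_pdivlMr; last lra.
  nra.
have t2 : n%:R ^+ 2 * (3 * q%:R + 1) ^- 3 <= c%:R ^+ 2 / q%:R :> R.
  have L0 : 0 < 3 * q%:R + 1 :> R by lra.
  rewrite ler_pdivrMr ?exprn_gt0// mulrAC ler_pdivlMr; last lra.
  have n2 : n%:R ^+ 2 <= (c%:R * (q%:R + 1)) ^+ 2 :> R by rewrite lerXn2r ?nnegrE//; nra.
  apply: (@le_trans _ _ ((c%:R * (q%:R + 1)) ^+ 2 * q%:R)).
    by apply: ler_wpM2r => //; lra.
  rewrite exprMn -mulrA; apply: ler_wpM2l; first exact: exprn_ge0.
  rewrite !exprS expr0; nra.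
have t3 : 3 * n%:R ^+ 2 * n%:R ^- 3 <= 3 / q%:R :> R.
  have -> : 3 * n%:R ^+ 2 * n%:R ^- 3 = 3 / n%:R :> R by field; lra.
  by rewrite ler_pM2l// lef_pV2 ?posrE//; nra.
have s1 : 4 / c%:R <= e / 2 :> R.
  rewrite ler_pdivrMr; last lra.
  by rewrite mulrAC ler_pdivlMr; lra.
have s2 : c%:R ^+ 2 / q%:R + 3 / q%:R <= e / 2.
  rewrite -mulrDl ler_pdivrMr; last lra.
  rewrite mulrAC ler_pdivlMr; last lra.
  nra.
lra.
Qed.

(** * Convergence in probability *)

(** Needed because the probability of a set is meaningful, and in particular
    monotone, only on measurable sets. *)
Lemma measurable_KL_entropy (R : realType) (d : measure_display)
    (Omega : measurableType d) (P : probability Omega R)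
    (X : nat -> {RV P >-> R}) (n : nat) :
  measurable_fun [set: Omega] (fun w => KL_entropy (fun i => X i w) n).
Proof.
apply: measurable_funD; last exact: measurable_cst.
apply: measurable_funM; first exact: measurable_cst.
apply: measurable_sum => i.
apply: (measurableT_comp (@measurable_ln R)).
apply: measurable_funM; last exact: measurable_cst.
apply: measurable_funM; first exact: measurable_cst.
apply: (measurableT_comp (fine_measurable measurableT)).
elim: (index_enum _) => [|k s IH].
  by under eq_fun do rewrite big_nil; exact: measurable_cst.
case ki : (k != i); under eq_fun do rewrite big_cons ki; last exact: IH.
apply: measurable_mine => //.
apply: measurableT_comp => //; apply: measurableT_comp => //.
by apply: measurable_funB.
Qed.

Theorem theorem3 (R : realType) (d : measure_display) (Omega : measurableType d)
    (P : probability Omega R) (X : nat -> {RV P >-> R})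
    (hindep : mutually_independent X)
    (hdensity : forall i : nat, has_density (X i) (\1_(supportA R))) :
  cvg_pinfty_in_probability P (fun n w => KL_entropy (fun i => X i w) n).
Proof.
move=> K.
have mH n : measurable [set w | K < KL_entropy (fun i => X i w) n].
  have -> : [set w | K < KL_entropy (fun i => X i w) n] =
      (fun w => KL_entropy (fun i => X i w) n) @^-1` `]K, +oo[.
    by apply/seteqP; split => w /=; rewrite in_itv/= andbT.
  by rewrite -[X in measurable X]setTI; apply: measurable_KL_entropy.
have pfin n : P [set w | K < KL_entropy (fun i => X i w) n] \is a fin_num.
  exact: fin_num_measure.
apply/fine_cvgP; split; first exact: nearW.
apply/cvgrPdist_le => e e0.
have [c c0 smallq] := bad_bound_small e0.
have growq := lone_point_dominates (K - euler_mascheroni R) c0.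
have [Q _ HQ] := filterI smallq growq.
exists (c * Q + 2)%N => // n /= nQ.
pose q := (n %/ c)%N.
have qn : (c * q <= n < c * q.+1)%N.
  by rewrite /q mulnC leq_trunc_div/= mulnC ltn_ceil.
have Qq : (Q <= q)%N by rewrite /q leq_divRL// mulnC; lia.
have [small grow] := HQ q Qq.
have n1 : (1 < n)%N by lia.
have n0 : (0 < n)%N by lia.
have {}small := small n n0 qn; have {}grow := grow n n0 qn.
have r0 : 0 < n%:R ^- 3 :> R by rewrite invr_gt0 exprn_gt0// ltr0n.
have r1 : n%:R ^- 3 <= 1 :> R.
  by rewrite invf_le1 ?exprn_gt0 ?ltr0n// exprn_ege1// ler1n.
(* The additive constant of the estimate has been absorbed in the level [K] to
   which the growth was applied. *)
have sub : ~` bad_event X n (3 * q) (n%:R ^- 3) `<=`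
    [set w | K < KL_entropy (fun i => X i w) n].
  move=> w /(KL_entropy_ge_off_bad n1 r0 r1) /=; apply: lt_le_trans.
  by rewrite -ltrBlDr.
have mB := measurable_bad X n (3 * q) (n%:R ^- 3).
have pB := prob_bad_le (3 * q) hindep hdensity n0 r0.
have h : (1 - P (bad_event X n (3 * q) (n%:R ^- 3)) <=
    P [set w | (K < KL_entropy (fun i => X i w) n)%R])%E.
  rewrite -probability_setC//; apply: le_measure; rewrite ?inE//.
  exact: measurableC.
have h1 := probability_le1 P (mH n).
rewrite -(fineK (pfin n)) lee_fin in h1.
rewrite /= ger0_norm ?subr_ge0//.
rewrite -(fineK (pfin n)) in h.
have pBfin : P (bad_event X n (3 * q) (n%:R ^- 3)) \is a fin_num.
  exact: fin_num_measure.
rewrite -(fineK pBfin) -EFinB lee_fin in h.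
rewrite -(fineK pBfin) lee_fin in pB.
apply: le_trans (le_trans pB small).
by rewrite lerBlDr -lerBlDl.
Qed.
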